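(* Let $\Omega_X$ and $\mathsf{Y}$ be standard Borel spaces, and let $K$ be a finite-class partition kernel on $\Omega_X$ with associated measurable map $\pi:\Omega_X\to\{1,\dots,m\}$. For any jointly distributed pair $(X,Y)$ with $X$ valued in $\Omega_X$ and $Y$ valued in $\mathsf{Y}$, writing $Z:=\pi(X)$, $$H_K(X)=H(Z),\qquad H_K(X\mid Y)=H(Z\mid Y),$$ where $H(Z)$ is the Shannon entropy and $H(Z\mid Y)$ is the usual Shannon conditional entropy. Consequently, $$I_K(X;Y)=I(Z;Y)\ge 0,$$ where $I(Z;Y)$ is the Shannon mutual information.
   Context: A similarity kernel on a measurable space $\Omega$ is a measurable map $K:\Omega\times\Omega\to[0,1]$ that is symmetric and satisfies $K(\omega,\omega)=1$ for all $\omega$. For a probability measure $\mu$ on $\Omega$, the typicality function is $\tau(\omega):=\int_\Omega K(\omega,\omega')\,d\mu(\omega')$ and the $K$-entropy is $H_K(\mu):=\int_\Omega(-\log\tau)\,d\mu\in[0,\infty]$, with $-\log 0:=+\infty$. For a random variable $X$ with law $\mu_X$, $H_K(X):=H_K(\mu_X)$. $K$ is a finite-class partition kernel on $\Omega_X$ if there exist an integer $m\ge1$ and a measurable map $\pi:\Omega_X\to\{1,\dots,m\}$ with $K(\omega,\omega')=\mathbf{1}\{\pi(\omega)=\pi(\omega')\}$. Conditional $K$-entropy: with $\{\mu_{X\mid Y=y}\}$ a regular conditional law of $X$ given $Y$ and $\mu_Y$ the law of $Y$, $H_K(X\mid Y=y):=H_K(\mu_{X\mid Y=y})$ and $H_K(X\mid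 Y):=\int_{\mathsf{Y}}H_K(X\mid Y=y)\,d\mu_Y(y)\in[0,\infty]$. When $H_K(X)$ and $H_K(X\mid Y)$ are finite, the $K$-information gain is $I_K(X;Y):=H_K(X)-H_K(X\mid Y)$. The Shannon conditional entropy of the finite-valued $Z$ is $H(Z\mid Y)=\int_{\mathsf{Y}}H(Z\mid Y=y)\,d\mu_Y(y)$, and $I(Z;Y)=H(Z)-H(Z\mid Y)$. *)

(* Defs.v *)
From HB Require Import structures.
From mathcomp Require Import all_boot all_order all_algebra.
From mathcomp Require Import all_classical all_reals all_analysis measurable_realfun.

Set Implicit Arguments.
Unset Strict Implicit.
Unset Printing Implicit Defensive.

Import Order.TTheory GRing.Theory Num.Theory.

Local Open Scope classical_set_scope.
Local Open Scope ring_scope.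

HB.instance Definition _ (m : nat) := isPointed.Build 'I_m.+1 ord0.
HB.instance Definition _ (m : nat) :=
  @isMeasurable.Build default_measure_display 'I_m.+1
    discrete_measurable discrete_measurable0
    discrete_measurableC discrete_measurableU.

(* [complete_metric] is the axiom of the library's completeType; the library
   has no join of metricType and completeType. *)
Definition complete_metric (R : realType) (M : metricType R) : Prop :=
  forall F : set_system M, ProperFilter F -> cauchy F ->
    exists x : M, F --> x.

Definition separable (M : topologicalType) : Prop :=
  exists2 D : set M, countable D & dense D.

(* T is Borel-isomorphic, through f, to a complete separable metric space. *)
Definition standard_borel (R : realType) (d : measure_display)
    (T : measurableType d) : Prop :=
  exists (M : metricType R) (f : T -> M),
    [/\ complete_metric M, separable M, bijective f,
        forall B : set M, <<s open >> B -> measurable (f @^-1` B) &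
        forall A : set T, measurable A -> <<s open >> (f @` A)].

Section similarity_kernels.
Context (R : realType) (d : measure_display) (T : measurableType d).
Implicit Types (K : T -> T -> R) (mu : {measure set T -> \bar R}).

Record similarity_kernel K : Prop := SimilarityKernel {
  simker_measurable : measurable_fun [set: T * T] (fun x => K x.1 x.2);
  simker_itv : forall x y, 0 <= K x y <= 1;
  simker_sym : forall x y, K x y = K y x;
  simker_diag : forall x, K x x = 1 }.

(* The number of classes, which is at least 1, is m.+1. *)
Definition partition_kernel (m : nat) (pi : {mfun T >-> 'I_m.+1}) K : Prop :=
  forall x y, K x y = (pi x == pi y)%:R.

Definition finite_class_partition_kernel K : Prop :=
  exists (m : nat) (pi : {mfun T >-> 'I_m.+1}), partition_kernel pi K.

Lemma finite_class_partition_kernel_similarity K :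
  finite_class_partition_kernel K -> similarity_kernel K.
Proof.
move=> [m [pi Kpi]]; split; last 3 first.
- by move=> x y; rewrite Kpi; case: (_ == _); rewrite ?lexx ?ler01.
- by move=> x y; rewrite !Kpi eq_sym.
- by move=> x; rewrite Kpi eqxx.
pose A := \big[setU/set0]_(i < m.+1) ((pi @^-1` [set i]) `*` (pi @^-1` [set i])).
have mA : measurable A.
  apply: bigsetU_measurable => i _.
  by apply: measurableX; exact: measurable_funPTI.
suff -> : (fun x : T * T => K x.1 x.2) = \1_A by exact: measurable_indic.
apply/funext => -[x y] /=; rewrite Kpi indicE; congr ((nat_of_bool _)%:R).
apply/eqP/idP => [xy|].
  rewrite inE /A -bigcup_mkord_ord; exists (pi x) => //=.
  by rewrite -xy inord_val.
by rewrite inE /A -bigcup_mkord_ord => -[i _ [/= -> ->]].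
Qed.

Local Open Scope ereal_scope.

Definition typicality K mu (x : T) : \bar R := \int[mu]_y (K x y)%:E.

(* [lne 0 = -oo], so the integrand is +oo where the typicality vanishes. *)
Definition K_entropy K mu : \bar R := \int[mu]_x (- lne (typicality K mu x)).

End similarity_kernels.

(* [ln 0 = 0] in the library, which gives the convention 0 log 0 = 0. *)
Definition shannon_entropy (R : realType) (m : nat)
    (mu : {measure set 'I_m.+1 -> \bar R}) : R :=
  - \sum_(i < m.+1) fine (mu [set i]) * ln (fine (mu [set i])).

Section conditional_entropies.
Context (R : realType) (d dX dY : measure_display).
Context (T : measurableType d) (TX : measurableType dX)
  (TY : measurableType dY) (P : probability T R).
Local Open Scope ereal_scope.

(* k is a version of the regular conditional law of X given Y. *)
Definition regular_conditional_law (X : {RV P >-> TX}) (Y : {RV P >-> TY})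
    (k : R.-pker TY ~> TX) : Prop :=
  forall (A : set TX) (B : set TY), measurable A -> measurable B ->
    P (X @^-1` A `&` Y @^-1` B) = \int[distribution P Y]_(y in B) k y A.

(* In the definitions below, k is meant to be a version of the regular
   conditional law given Y. *)
Definition cond_K_entropy (K : TX -> TX -> R) (Y : {RV P >-> TY})
    (k : R.-pker TY ~> TX) : \bar R :=
  \int[distribution P Y]_y K_entropy K (k y).

(* Meaningful when both terms are finite. *)
Definition K_information_gain (K : TX -> TX -> R) (X : {RV P >-> TX})
    (Y : {RV P >-> TY}) (k : R.-pker TY ~> TX) : \bar R :=
  K_entropy K (distribution P X) - cond_K_entropy K Y k.

Definition cond_shannon_entropy (m : nat) (Y : {RV P >-> TY})
    (k : R.-pker TY ~> 'I_m.+1) : \bar R :=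
  \int[distribution P Y]_y (shannon_entropy (k y))%:E.

Definition mutual_information (m : nat) (Z : {RV P >-> 'I_m.+1})
    (Y : {RV P >-> TY}) (k : R.-pker TY ~> 'I_m.+1) : \bar R :=
  (shannon_entropy (distribution P Z))%:E - cond_shannon_entropy Y k.

End conditional_entropies.

Arguments regular_conditional_law {R d dX dY T TX TY} P X Y k.
Arguments cond_K_entropy {R d dX dY T TX TY} P K Y k.
Arguments K_information_gain {R d dX dY T TX TY} P K X Y k.
Arguments cond_shannon_entropy {R d dY T TY} P {m} Y k.
Arguments mutual_information {R d dY T TY} P {m} Z Y k.

(* Main.v *)
Require Import Defs.
From mathcomp Require Import all_boot all_order all_algebra.
From mathcomp Require Import all_classical all_reals all_analysis measurable_realfun.
From mathcomp Require Import lra.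

(** For the kernel of the partition into classes [A_i = pi^-1 {i}], the
    typicality of a point is the mass of its own class.  So [- log tau] is
    constant on each [A_i], with value [- log mu(A_i)], and integrating it class
    by class gives [\sum_i - mu(A_i) log mu(A_i)], the Shannon entropy of the law
    of [pi] ([K_entropy_partition]).  A class of mass zero, on which the integrand
    is [+oo], contributes [+oo * 0 = 0], which is the convention [0 log 0 = 0].

    The conditional identity is this one applied to the law of [X] given
    [Y = y], for each [y].  The kernels [kX] and [kZ] are arbitrary versions of
    the two conditional laws, so [kX y A_i] and [kZ y {i}] need only agree for
    almost every [y]: both have the integral [P (Z = i, Y \in B)] over every
    measurable [B] ([conditional_law_comp_ae]).  The entropies given [Y = y] then
    agree almost everywhere, which is enough once they are integrated.

    Nonnegativity of the mutual information is the concavity of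
    [h t = - t log t].  The mean over [y] of [kZ y {i}] is [P (Z = i)], so Jensen's
    inequality for [h] ([integral_mean_surprisal_le]), summed over [i], gives
    [H(Z | Y) <= H(Z)] ([cond_shannon_entropy_le]).  As [H(Z)] is a real number
    and [H(Z | Y)] is nonnegative, this also shows that both entropies are
    finite. *)

Set Implicit Arguments.
Unset Strict Implicit.
Unset Printing Implicit Defensive.

Import Order.TTheory GRing.Theory Num.Theory.

Local Open Scope classical_set_scope.
Local Open Scope ring_scope.

(** * The function [- t log t] *)

Section surprisal.
Context {R : realType}.
Implicit Types p q t : R.

(** The contribution of an event of probability [t] to a Shannon entropy:
    [t] times its surprisal [- log t]. *)
Definition mean_surprisal t : R := - (t * ln t).

Lemma measurable_mean_surprisal : measurable_fun [set: R] mean_surprisal.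
Proof.
by apply: measurableT_comp => //; apply: measurable_funM => //;
  exact: measurable_ln.
Qed.

(** By concavity the graph lies below its tangent at [p]; here this is the bound
    [log x <= x - 1] at [x = p / q].  It turns Jensen's inequality into the
    integration of an affine function. *)
Lemma mean_surprisal_le_tangent p q :
  0 < p -> 0 <= q -> mean_surprisal q <= p - q - q * ln p.
Proof.
move=> p0; rewrite le_eqVlt => /predU1P[<-|q0].
  by rewrite /mean_surprisal !mul0r oppr0 !addr0 ltW.
have pq0 : 0 < p / q by rewrite divr_gt0.
suff : q * (ln p - ln q) <= p - q by rewrite /mean_surprisal mulrBr; lra.
have -> : p - q = q * (p / q - 1).
  by rewrite mulrBr mulr1 mulrCA divff ?mulr1// gt_eqF.
rewrite -ln_div ?posrE// ler_pM2l//.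
have -> : ln (p / q) = ln (1 + (p / q - 1)) by rewrite addrC subrK.
by apply: le_ln1Dx; lra.
Qed.

Lemma mean_surprisal_itv q : 0 <= q <= 1 -> 0 <= mean_surprisal q <= 1.
Proof.
move=> /andP[q0 q1]; apply/andP; split.
  by rewrite oppr_ge0 mulr_ge0_le0// ln_le0.
(* The tangent at 1 is [1 - q]. *)
have := mean_surprisal_le_tangent ltr01 q0; rewrite ln1 mulr0; lra.
Qed.

End surprisal.

Lemma shannon_entropyE (R : realType) (m : nat)
    (nu : {measure set 'I_m.+1 -> \bar R}) :
  shannon_entropy nu = \sum_(i < m.+1) mean_surprisal (fine (nu [set i])).
Proof. by rewrite /shannon_entropy -sumrN. Qed.

Local Open Scope ereal_scope.

Lemma fine_measure_itv (R : realType) (d : measure_display)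
    (T : measurableType d) (mu : {measure set T -> \bar R}) (A : set T) :
  measurable A -> mu setT = 1 -> (0 <= fine (mu A) <= 1)%R.
Proof.
move=> mA mu1.
have muA1 : mu A <= 1 by rewrite -mu1 le_measure ?inE.
have muAfin : mu A \is a fin_num.
  by rewrite ge0_fin_numE// (le_lt_trans muA1)// ltry.
by rewrite fine_ge0//= -lee_fin fineK.
Qed.

Lemma measure_fineK (R : realType) (d : measure_display)
    (T : measurableType d) (mu : {measure set T -> \bar R}) (A : set T) :
  measurable A -> mu setT = 1 -> (fine (mu A))%:E = mu A.
Proof.
move=> mA mu1; rewrite fineK// ge0_fin_numE//.
by rewrite (@le_lt_trans _ _ 1) ?ltry// -mu1 le_measure ?inE.
Qed.

(** * Entropy of a partition kernel *)

Section partition_entropy.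
Context {R : realType} {d : measure_display} {T : measurableType d} {m : nat}.
Variables (pi : {mfun T >-> 'I_m.+1}) (K : T -> T -> R).
Hypothesis hK : partition_kernel pi K.
Implicit Types mu : {measure set T -> \bar R}.

Let mclass i : measurable (pi @^-1` [set i]).
Proof. exact: measurable_funPTI. Qed.

Lemma typicality_partition mu x : typicality K mu x = mu (pi @^-1` [set pi x]).
Proof.
rewrite /typicality -[X in mu X]setIT -integral_indic//.
apply: eq_integral => y _; rewrite hK indicE; congr ((nat_of_bool _)%:R%:E).
by apply/eqP/idP => [->|]; rewrite inE.
Qed.

(** The classes are finitely many, disjoint and cover the space, and the
    integrand [- log tau] is nonnegative and constant on each of them. *)
Lemma K_entropy_partition mu : mu setT = 1 ->
  K_entropy K mu =
  (\sum_(i < m.+1) mean_surprisal (fine (mu (pi @^-1` [set i]))))%:E.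
Proof.
move=> mu1; rewrite /K_entropy.
pose g i := - lne (mu (pi @^-1` [set i])).
under eq_integral do rewrite typicality_partition.
have coverT : \big[setU/set0]_(i <- enum 'I_m.+1) (pi @^-1` [set i]) = setT.
  rewrite -subTset => x _; rewrite -bigcup_seq; exists (pi x) => //=.
  by rewrite mem_enum.
rewrite -coverT.
rewrite (@ge0_integral_bigsetU _ _ _ mu _ (fun i => pi @^-1` [set i]) _
  (enum 'I_m.+1)) ?enum_uniq//; last 3 first.
- by apply/trivIsetP => i j _ _ ij; apply/seteqP; split => x //= [->] /eqP;
    rewrite (negbTE ij).
(* The integrand is [g \o pi], and every function on a finite discrete space
   is measurable. *)
- by rewrite coverT; exact: (measurableT_comp (f := g)).
- by move=> x _; rewrite oppe_ge0 lne_le0 -mu1 le_measure ?inE.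
rewrite big_enum/= -sumEFin; apply: eq_bigr => i _.
rewrite (eq_integral (cst (g i))); last first.
  by move=> x; rewrite inE /g /= => ->.
rewrite integral_cst// /g -(measure_fineK (mclass i) mu1).
have /andP[] := fine_measure_itv (mclass i) mu1.
(* A null class contributes [- lne 0 * 0 = +oo * 0 = 0]. *)
rewrite le_eqVlt => /predU1P[<- _|p0 _].
  by rewrite mule0 /mean_surprisal mul0r oppr0.
by rewrite lne_EFin// -EFinN -EFinM mulNr mulrC.
Qed.

End partition_entropy.

(** * Jensen's inequality for [- t log t] *)

Section expected_surprisal.
Context {R : realType} {d : measure_display} {T : measurableType d}.
Variable Q : probability T R.

Let Q1 : (Q : {measure set T -> \bar R}) setT = 1.
Proof. exact: probability_setT. Qed.

Lemma integrable_unit (f : T -> R) : measurable_fun setT f ->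
  (forall x, 0 <= f x <= 1)%R -> Q.-integrable setT (EFin \o f).
Proof.
move=> mf f01; apply: measurable_bounded_integrable => //.
  by rewrite Q1 ltry.
exists 1%R; split => // M M1 x _ /=.
by have /andP[f0 f1] := f01 x; rewrite ger0_norm// (le_trans f1)// ltW.
Qed.

(** Integrating the tangent at the mean [p] of [f] cancels its linear part and
    leaves the value at [p].  There is no tangent at [p = 0], but then [f] is
    almost everywhere zero and both sides vanish. *)
Lemma integral_mean_surprisal_le (f : T -> R) (p : R) :
  measurable_fun setT f -> (forall x, 0 <= f x <= 1)%R ->
  \int[Q]_x (f x)%:E = p%:E ->
  \int[Q]_x (mean_surprisal (f x))%:E <= (mean_surprisal p)%:E.
Proof.
move=> mf f01 Ef.
have if_ := integrable_unit mf f01.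
have mh : measurable_fun setT (mean_surprisal \o f).
  by apply: measurableT_comp => //; exact: measurable_mean_surprisal.
have ih : Q.-integrable setT (EFin \o (mean_surprisal \o f)).
  by apply: integrable_unit => // x; exact: mean_surprisal_itv.
have : (0 <= p)%R.
  rewrite -lee_fin -Ef integral_ge0// => x _.
  by rewrite lee_fin; have /andP[] := f01 x.
rewrite le_eqVlt => /predU1P[p0|p0].
  have f0 : ae_eq Q setT (EFin \o f) (cst 0).
    apply/ae_eq_integral_abs => //; first exact/measurable_EFinP.
    rewrite -[RHS]/(0%R%:E) p0 -Ef; apply: eq_integral => x _ /=.
    by have /andP[? _] := f01 x; rewrite ger0_norm.
  rewrite (ae_eq_integral (cst 0)) ?integral0//.
  - by rewrite -p0 /mean_surprisal mul0r oppr0.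
  - exact/measurable_EFinP.
  - apply: filterS f0 => x /= /[apply] -[->].
    by rewrite /mean_surprisal mul0r oppr0.
have ic : Q.-integrable setT (cst p%:E) by exact: finite_measure_integrable_cst.
have il : Q.-integrable setT (fun x => (1 + ln p)%:E * (f x)%:E).
  exact: integrableZl.
apply: (@le_trans _ _ (\int[Q]_x (p%:E - (1 + ln p)%:E * (f x)%:E))).
  apply: le_integral => //; first exact: integrableB.
  move=> x _; rewrite -EFinM -EFinB lee_fin.
  have /andP[f0 _] := f01 x.
  by have := mean_surprisal_le_tangent p0 f0; lra.
rewrite integralB// integral_cst// integralZl// Ef.
rewrite Q1 mule1 -EFinM -EFinB lee_fin /mean_surprisal.
by lra.
Qed.

End expected_surprisal.

(** * Conditional laws and conditional entropies *)

Section conditional_law.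
Context {R : realType} {d dY : measure_display} {T : measurableType d}
  {TY : measurableType dY} {P : probability T R} {Y : {RV P >-> TY}}.

Lemma kernel_measurable_fine (dX : measure_display) (TX : measurableType dX)
    (k : R.-pker TY ~> TX) (A : set TX) :
  measurable A -> measurable_fun setT (fun y => fine (k y A)).
Proof.
by move=> mA; apply: measurableT_comp => //; exact: measurable_kernel.
Qed.

(** Both functions of [y] have the integral [P (X \in f^-1 A, Y \in B)] over each
    measurable [B], and integrable functions with equal integrals over all
    measurable sets agree almost everywhere.  The equation on [Z] is between
    functions, so that [Z] may be any bundled random variable. *)
Lemma conditional_law_comp_ae (dX dZ : measure_display)
    (TX : measurableType dX) (TZ : measurableType dZ)
    (X : {RV P >-> TX}) (Z : {RV P >-> TZ}) (f : TX -> TZ)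
    (kX : R.-pker TY ~> TX) (kZ : R.-pker TY ~> TZ) (A : set TZ) :
  regular_conditional_law P X Y kX -> regular_conditional_law P Z Y kZ ->
  (Z : T -> TZ) = f \o X ->
  measurable A -> measurable (f @^-1` A) ->
  ae_eq (distribution P Y) setT (fun y => kX y (f @^-1` A)) (fun y => kZ y A).
Proof.
move=> hX hZ ZE mA mfA.
apply: integral_ae_eq => //.
- have -> : (fun y => kX y (f @^-1` A)) =
            EFin \o (fun y => fine (kX y (f @^-1` A))).
    by apply/funext => y /=; rewrite measure_fineK// prob_kernel.
  apply: integrable_unit => [|y]; first exact: kernel_measurable_fine.
  by apply: fine_measure_itv => //; exact: prob_kernel.
- exact: measurable_kernel.
- by move=> B _ mB; rewrite -hX// -hZ// ZE.
Qed.

(** The law of total probability: the defining property of the conditional law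
    at [B = setT]. *)
Lemma integral_conditional_law (dX : measure_display) (TX : measurableType dX)
    (X : {RV P >-> TX}) (k : R.-pker TY ~> TX) (A : set TX) :
  regular_conditional_law P X Y k -> measurable A ->
  \int[distribution P Y]_y (fine (k y A))%:E = distribution P X A.
Proof.
move=> hk mA; rewrite -[RHS]/(P (X @^-1` A)) -[X @^-1` A]setIT.
rewrite -[setT in RHS](preimage_setT Y) hk//.
by apply: eq_integral => y _; rewrite measure_fineK// prob_kernel.
Qed.

Lemma measurable_cond_surprisal (dX : measure_display) (TX : measurableType dX)
    (k : R.-pker TY ~> TX) (A : set TX) : measurable A ->
  measurable_fun setT (fun y => (mean_surprisal (fine (k y A)))%:E).
Proof.
move=> mA; apply/measurable_EFinP; apply: measurableT_comp.
  exact: measurable_mean_surprisal.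
exact: kernel_measurable_fine.
Qed.

Lemma mean_surprisal_kernel_itv (dX : measure_display)
    (TX : measurableType dX) (k : R.-pker TY ~> TX) (A : set TX) y :
  measurable A -> (0 <= mean_surprisal (fine (k y A)) <= 1)%R.
Proof.
by move=> mA; apply/mean_surprisal_itv/fine_measure_itv; rewrite ?prob_kernel.
Qed.

Lemma cond_shannon_entropy_sum (m : nat) (k : R.-pker TY ~> 'I_m.+1) :
  cond_shannon_entropy P Y k =
  \sum_(i < m.+1)
    \int[distribution P Y]_y (mean_surprisal (fine (k y [set i])))%:E.
Proof.
rewrite /cond_shannon_entropy.
under eq_integral do rewrite shannon_entropyE -sumEFin.
rewrite ge0_integral_sum//.
- by move=> i; exact: measurable_cond_surprisal.
- move=> i y _; rewrite lee_fin.
  by case/andP: (mean_surprisal_kernel_itv k y (A := [set i]) I).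
Qed.

Lemma cond_shannon_entropy_ge0 (m : nat) (k : R.-pker TY ~> 'I_m.+1) :
  0 <= cond_shannon_entropy P Y k.
Proof.
rewrite cond_shannon_entropy_sum sume_ge0// => i _.
apply: integral_ge0 => y _; rewrite lee_fin.
by case/andP: (mean_surprisal_kernel_itv k y (A := [set i]) I).
Qed.

(** Conditioning reduces entropy, by Jensen's inequality in each coordinate
    [i], where [P (Z = i)] is the mean of the conditional probabilities. *)
Lemma cond_shannon_entropy_le (m : nat) (Z : {RV P >-> 'I_m.+1})
    (k : R.-pker TY ~> 'I_m.+1) : regular_conditional_law P Z Y k ->
  cond_shannon_entropy P Y k <= (shannon_entropy (distribution P Z))%:E.
Proof.
move=> hk; rewrite cond_shannon_entropy_sum shannon_entropyE -sumEFin.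
apply: lee_sum => i _; apply: integral_mean_surprisal_le.
- exact: kernel_measurable_fine.
- by move=> y; apply: fine_measure_itv => //; exact: prob_kernel.
- rewrite (integral_conditional_law hk)// measure_fineK//.
  exact: probability_setT.
Qed.

(** The two sides use unrelated kernels; after both are written as sums over the
    classes, the summands are integrals of functions equal almost everywhere. *)
Lemma cond_K_entropy_partition (dX : measure_display) (TX : measurableType dX)
    (m : nat) (pi : {mfun TX >-> 'I_m.+1}) (K : TX -> TX -> R)
    (X : {RV P >-> TX}) (Z : {RV P >-> 'I_m.+1})
    (kX : R.-pker TY ~> TX) (kZ : R.-pker TY ~> 'I_m.+1) :
  partition_kernel pi K -> (Z : T -> 'I_m.+1) = pi \o X ->
  regular_conditional_law P X Y kX -> regular_conditional_law P Z Y kZ ->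
  cond_K_entropy P K Y kX = cond_shannon_entropy P Y kZ.
Proof.
move=> hK ZE hX hZ; rewrite cond_shannon_entropy_sum /cond_K_entropy.
have mpi i : measurable (pi @^-1` [set i]) by exact: measurable_funPTI.
under eq_integral do
  rewrite (K_entropy_partition hK (prob_kernel _)) -sumEFin.
rewrite ge0_integral_sum//.
- apply: eq_bigr => i _; apply: ae_eq_integral => //.
  + exact: measurable_cond_surprisal.
  + exact: measurable_cond_surprisal.
  + have := conditional_law_comp_ae hX hZ ZE (I : measurable [set i]) (mpi i).
    by apply: filterS => y /= /[apply] ->.
- by move=> i; exact: measurable_cond_surprisal.
- move=> i y _; rewrite lee_fin.
  by case/andP: (mean_surprisal_kernel_itv kX y (mpi i)).
Qed.

End conditional_law.

Theorem proposition6p4 (R : realType) (d dX dY : measure_display)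
    (T : measurableType d) (TX : measurableType dX) (TY : measurableType dY)
    (hX : standard_borel R TX) (hY : standard_borel R TY)
    (m : nat) (pi : {mfun TX >-> 'I_m.+1}) (K : TX -> TX -> R)
    (hK : partition_kernel pi K)
    (P : probability T R) (X : {RV P >-> TX}) (Y : {RV P >-> TY})
    (Z : {RV P >-> 'I_m.+1} := (pi \o X)%FUN)
    (kX : R.-pker TY ~> TX) (hkX : regular_conditional_law P X Y kX)
    (kZ : R.-pker TY ~> 'I_m.+1) (hkZ : regular_conditional_law P Z Y kZ) :
  [/\ K_entropy K (distribution P X) = (shannon_entropy (distribution P Z))%:E,
      cond_K_entropy P K Y kX = cond_shannon_entropy P Y kZ,
      K_entropy K (distribution P X) \is a fin_num /\
        cond_K_entropy P K Y kX \is a fin_num,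
      K_information_gain P K X Y kX = mutual_information P Z Y kZ &
      0 <= mutual_information P Z Y kZ].
Proof.
have HK : K_entropy K (distribution P X) =
          (shannon_entropy (distribution P Z))%:E.
  rewrite (K_entropy_partition hK) ?shannon_entropyE//.
  exact: probability_setT.
have HKY : cond_K_entropy P K Y kX = cond_shannon_entropy P Y kZ.
  exact: cond_K_entropy_partition hK _ hkX hkZ.
have le_HZ := cond_shannon_entropy_le hkZ.
have fin_HZY : cond_shannon_entropy P Y kZ \is a fin_num.
  rewrite ge0_fin_numE ?cond_shannon_entropy_ge0//.
  by rewrite (le_lt_trans le_HZ)// ltry.
split => //.
- by rewrite HK HKY.
- by rewrite /K_information_gain HK HKY.
- by rewrite /mutual_information sube_ge0// fin_HZY.
Qed.
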